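(* For each of the following sets $R\subseteq\{0,1,2,3\}^2$ we have $(123,R)\sim_d(132,R)$: (1) $R=\{(0,0),(0,1),(0,2),(1,0),(2,0),(2,2)\}$; (2) $R=\{(0,0),(0,1),(0,2),(1,0),(1,2),(2,0),(2,1),(2,3),(3,2)\}$; (3) $R=\{(0,0),(0,1),(0,2),(1,0),(1,1),(1,3),(2,0),(3,1),(3,3)\}$; (4) $R=\{(0,0),(0,1),(0,2),(1,0),(1,1),(1,3),(2,0),(2,2),(3,1),(3,3)\}$; (5) $R=\{(0,0),(0,1),(0,2),(1,0),(1,2),(2,0),(2,1),(2,2),(2,3),(3,2)\}$; (6) $R=\{(0,0),(0,1),(0,2),(1,0),(1,1),(1,2),(1,3),(2,0),(2,1),(2,3),(3,1),(3,2),(3,3)\}$; (7) $R=\{(0,0),(0,1),(0,2),(1,0),(1,1),(1,2),(1,3),(2,0),(2,1),(2,2),(2,3),(3,1),(3,2),(3,3)\}$.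
   Context: $S_n$ denotes the set of permutations of $[n]=\{1,\dots,n\}$, written $\pi=\pi_1\cdots\pi_n$. A mesh pattern of length $k$ is a pair $(\tau,R)$ with $\tau\in S_k$ and $R\subseteq\{0,1,\dots,k\}^2$ (the shaded boxes; box $(a,b)$ is the unit square $[a,a+1]\times[b,b+1]$ in the diagram of $\tau$). An occurrence of $(\tau,R)$ in $\pi\in S_n$ is a choice of indices $i_1<\dots<i_k$ such that $\pi_{i_1}\cdots\pi_{i_k}$ is order-isomorphic to $\tau$ and, with $i_0=0$, $i_{k+1}=n+1$, $v_1<\dots<v_k$ the values $\pi_{i_1},\dots,\pi_{i_k}$ sorted increasingly, $v_0=0$, $v_{k+1}=n+1$, for every $(a,b)\in R$ there is no index $m$ with $i_a<m<i_{a+1}$ and $v_b<\pi_m<v_{b+1}$. Mesh patterns $p,q$ are equidistributed, $p\sim_d q$, if for all $n,\ell\ge0$ the number of $\pi\in S_n$ with exactly $\ell$ occurrences of $p$ equals the number with exactly $\ell$ occurrences of $q$. *)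

(* Defs.v *)
From mathcomp Require Import all_boot all_fingroup.

Set Implicit Arguments.
Unset Strict Implicit.
Unset Printing Implicit Defensive.

(* Permutations of [n] are elements of 'S_n, acting on {0, ..., n-1}: the i-th
   letter (i >= 1) of the word of pi is (pi (i - 1)) + 1. *)
Definition one_line n (pi : 'S_n) : seq nat := [seq (pi i).+1 | i <- enum 'I_n].

Record mesh_pattern (k : nat) := MeshPattern {
  underlying : 'S_k;
  shading : {set 'I_k.+1 * 'I_k.+1}
}.

Definition boxes (k : nat) (s : seq (nat * nat)) : {set 'I_k.+1 * 'I_k.+1} :=
  [set ab : 'I_k.+1 * 'I_k.+1 | (nat_of_ord ab.1, nat_of_ord ab.2) \in s].

Section Occurrences.

Variables (n k : nat) (pi : 'S_n) (i : {ffun 'I_k -> 'I_n}).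

(* i_0 = 0, i_1, ..., i_k, i_(k+1) = n + 1, as 1-based positions in pi. *)
Definition grid_pos (a : nat) : nat :=
  nth 0 (0 :: rcons [seq (i j).+1 | j <- enum 'I_k] n.+1) a.

(* v_0 = 0, v_1 < ... < v_k, v_(k+1) = n + 1, as 1-based values of pi. *)
Definition grid_val (b : nat) : nat :=
  nth 0 (0 :: rcons (sort leq [seq (pi (i j)).+1 | j <- enum 'I_k]) n.+1) b.

Definition in_box (a b : nat) (m : 'I_n) : bool :=
  (grid_pos a < m.+1 < grid_pos a.+1) &&
  (grid_val b < (pi m).+1 < grid_val b.+1).

Definition is_occurrence (p : mesh_pattern k) : bool :=
  [&& [forall a : 'I_k, forall b : 'I_k, (a < b) ==> (i a < i b)],
      [forall a : 'I_k, forall b : 'I_k,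
         (pi (i a) < pi (i b)) == (underlying p a < underlying p b)]
    & [forall ab in shading p, ~~ [exists m : 'I_n, in_box ab.1 ab.2 m]]].

End Occurrences.

Definition occurrences n k (p : mesh_pattern k) (pi : 'S_n) : nat :=
  #|[set i : {ffun 'I_k -> 'I_n} | is_occurrence pi i p]|.

Definition equidistributed k k' (p : mesh_pattern k) (q : mesh_pattern k') : Prop :=
  forall n l : nat,
    #|[set pi : 'S_n | occurrences p pi == l]| =
    #|[set pi : 'S_n | occurrences q pi == l]|.

Definition perm123 : 'S_3 := 1%g.
Definition perm132 : 'S_3 := tperm (inord 1) (inord 2).

Lemma one_line_perm123 : one_line perm123 = [:: 1; 2; 3].
Proof. by rewrite /one_line !enum_ordSl enum_ord0 /= !perm1. Qed.

Lemma one_line_perm132 : one_line perm132 = [:: 1; 3; 2].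
Proof.
rewrite /one_line !enum_ordSl enum_ord0 /= /perm132 !permE /=.
by rewrite -!val_eqE /= !inordK.
Qed.

(* Main.v *)
(** Let [phi] reverse, in the word of a permutation, each maximal run of letters
    strictly between two consecutive left-to-right minima; the positions and
    values of these minima do not change, so [phi] is an involution.

    Shading (0,0), (1,0) and (2,0) says that the first letter of an occurrence is
    a left-to-right minimum and that its other two letters lie in the run following
    it. Hence [phi] exchanges the positions of these two letters, turning 123 into
    132. It preserves columns 0 and 2 of the mesh, and exchanges column 1 with the
    part of column 3 inside the run, while the rest of column 3 is preserved. So
    any set of shaded boxes in which columns 1 and 3 agree above row 0 is
    respected. *)

Require Import Defs.
From mathcomp Require Import all_boot all_fingroup.
From mathcomp Require Import zify.

Set Implicit Arguments.
Unset Strict Implicit.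
Unset Printing Implicit Defensive.

(** A down-closed set is an initial segment, so its size is the first position outside it. This
    allows the end of a block to be defined by counting. *)
Lemma mem_down_closed n (A : {set 'I_n}) (m : 'I_n) :
  (forall i j : 'I_n, i <= j -> j \in A -> i \in A) -> (m \in A) = (m < #|A|).
Proof.
move=> dcA.
have card_lt (k : 'I_n) : #|[set i : 'I_n | i < k]| = k.
  rewrite -sum1_card (eq_bigl (fun i : 'I_n => i < k)); last by move=> i; rewrite inE.
  by rewrite -(big_ord_widen n (fun _ => 1) (ltnW (ltn_ord k))) sum1_card card_ord.
have [mA|mA] := boolP (m \in A).
  have : m |: [set i : 'I_n | i < m] \subset A.
    apply/subsetP=> i; rewrite !inE => /orP[/eqP->//|/ltnW im]; exact: dcA mA.
  by move/subset_leq_card; rewrite cardsU1 inE ltnn card_lt add1n => ->.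
apply/esym/negbTE; rewrite -leqNgt -[leqRHS]card_lt subset_leq_card //.
apply/subsetP=> i iA; rewrite inE ltnNge; apply: contra mA => mi; exact: dcA iA.
Qed.

(** * Left-to-right minima, blocks, and the involution [flip] *)

Section BlockReversal.

Variables (n : nat).
Implicit Types (pi : 'S_n) (x y m : 'I_n).

(** The position of the last left-to-right minimum at or before [y]; it serves as the label of the
    block of [y]. *)
Definition prefix_argmin pi y : 'I_n := [arg min_(m < y | m <= y) pi m].

Lemma prefix_argmin_le pi y : prefix_argmin pi y <= y.
Proof. by rewrite /prefix_argmin; case: arg_minnP. Qed.

Lemma prefix_argmin_min pi y m : m <= y -> pi (prefix_argmin pi y) <= pi m.
Proof. by rewrite /prefix_argmin; case: arg_minnP => // i _; apply. Qed.

Lemma prefix_argmin_uniq pi x y :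
  x <= y -> (forall m, m <= y -> pi x <= pi m) -> prefix_argmin pi y = x.
Proof.
move=> xy xmin; apply: (@perm_inj _ pi); apply: val_inj; apply/eqP.
by rewrite eqn_leq prefix_argmin_min //= xmin ?prefix_argmin_le.
Qed.

Lemma prefix_argmin_id pi y :
  prefix_argmin pi (prefix_argmin pi y) = prefix_argmin pi y.
Proof.
apply: prefix_argmin_uniq => // m my; apply: prefix_argmin_min.
exact: leq_trans my (prefix_argmin_le _ _).
Qed.

Lemma prefix_argmin_mono pi x y :
  x <= y -> prefix_argmin pi x <= prefix_argmin pi y.
Proof.
move=> xy; rewrite leqNgt; apply/negP => lt.
(* If the minimum of the longer prefix stood further left, it would already lie in the shorter
   prefix, and the two minima would coincide. *)
suff eq_xy : prefix_argmin pi y = prefix_argmin pi x by rewrite eq_xy ltnn in lt.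
apply: prefix_argmin_uniq; first exact: leq_trans (prefix_argmin_le _ _) xy.
move=> m my; apply: leq_trans (prefix_argmin_min _ my); apply: prefix_argmin_min.
exact: leq_trans (ltnW lt) (prefix_argmin_le _ _).
Qed.

Lemma prefix_argmin_between pi x y :
  prefix_argmin pi y <= x <= y -> prefix_argmin pi x = prefix_argmin pi y.
Proof.
case/andP=> yx xy; apply: val_inj; apply/eqP; rewrite eqn_leq.
by rewrite prefix_argmin_mono //= -{1}prefix_argmin_id prefix_argmin_mono.
Qed.

(* The blocks are the fibres of [prefix_argmin]: a left-to-right minimum and the
   run after it. [block_end pi y] is the first position past the block of [y]. *)
Definition block_end pi y : nat :=
  #|[set m | prefix_argmin pi m <= prefix_argmin pi y]|.

Lemma block_endP pi y m :
  (m < block_end pi y) = (prefix_argmin pi m <= prefix_argmin pi y).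
Proof.
rewrite /block_end -mem_down_closed ?inE // => i j ij; rewrite !inE.
exact/leq_trans/prefix_argmin_mono.
Qed.

Lemma block_end_le pi y : block_end pi y <= n.
Proof. by rewrite -[leqRHS]card_ord max_card. Qed.

(** With s the minimum's position and e the block end, the run occupies s + 1, ..., e - 1, so its
    reversal sends y to s + e - y. The default of [insubd] is never reached, as [block_rev_val]
    shows. *)
Definition block_rev pi y : 'I_n :=
  if prefix_argmin pi y == y then y
  else insubd y (prefix_argmin pi y + block_end pi y - y).

Lemma block_rev_val pi y : prefix_argmin pi y != y ->
  block_rev pi y = prefix_argmin pi y + block_end pi y - y :> nat.
Proof.
move=> sy; rewrite /block_rev (negbTE sy) val_insubd.
have := prefix_argmin_le pi y; have := block_end_le pi y.
have := block_endP pi y y; rewrite leqnn => ye.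
move: sy; rewrite -val_eqE /=; case: ifP => //; lia.
Qed.

Lemma block_rev_fix pi y : prefix_argmin pi y = y -> block_rev pi y = y.
Proof. by rewrite /block_rev => ->; rewrite eqxx. Qed.

Lemma prefix_argmin_rev pi y :
  prefix_argmin pi (block_rev pi y) = prefix_argmin pi y.
Proof.
have [sy|sy] := eqVneq (prefix_argmin pi y) y; first by rewrite block_rev_fix.
have rE := block_rev_val sy.
have le_sy := prefix_argmin_le pi y.
have := block_endP pi y y; rewrite leqnn => ye.
have : block_rev pi y < block_end pi y.
  by rewrite rE; move: sy; rewrite -val_eqE /=; lia.
rewrite block_endP => le1.
apply: val_inj; apply/eqP; rewrite eqn_leq le1 /=.
rewrite -{1}prefix_argmin_id prefix_argmin_mono //.
by rewrite rE; lia.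
Qed.

Lemma block_revK pi : involutive (block_rev pi).
Proof.
move=> y; have [sy|sy] := eqVneq (prefix_argmin pi y) y.
  by rewrite !block_rev_fix.
have rE := block_rev_val sy.
have le_sy := prefix_argmin_le pi y.
have := block_endP pi y y; rewrite leqnn => ye.
have sry : prefix_argmin pi (block_rev pi y) != block_rev pi y.
  by rewrite prefix_argmin_rev -val_eqE /= rE; lia.
apply: val_inj; rewrite /= block_rev_val // prefix_argmin_rev rE.
have -> : block_end pi (block_rev pi y) = block_end pi y.
  by rewrite /block_end prefix_argmin_rev.
lia.
Qed.

Lemma block_rev_lt pi x y : prefix_argmin pi x = prefix_argmin pi y ->
  prefix_argmin pi x < x -> x < y -> block_rev pi y < block_rev pi x.
Proof.
move=> sxy sx xy.
have sx' : prefix_argmin pi x != x by rewrite -val_eqE /= ltn_eqF.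
have sy' : prefix_argmin pi y != y.
  by rewrite -sxy -val_eqE /= ltn_eqF // (ltn_trans sx).
rewrite !block_rev_val // /block_end sxy -/(block_end pi y).
have := block_endP pi y y; rewrite leqnn => ye; lia.
Qed.

Lemma block_rev_ltn pi x y :
  prefix_argmin pi x < prefix_argmin pi y -> block_rev pi x < block_rev pi y.
Proof.
move=> sxy; rewrite ltnNge; apply/negP => /(prefix_argmin_mono pi).
by rewrite !prefix_argmin_rev leqNgt sxy.
Qed.

Definition flip pi : 'S_n := (perm (inv_inj (block_revK pi)) * pi)%g.

Lemma flipE pi y : flip pi y = pi (block_rev pi y).
Proof. by rewrite permM permE. Qed.

(** The minima stay in place, and every other letter stays in its block, hence above the minimum of
    that block. So [flip pi] has the blocks of [pi], which makes [flip] an involution. *)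
Lemma prefix_argmin_flip pi y : prefix_argmin (flip pi) y = prefix_argmin pi y.
Proof.
apply: prefix_argmin_uniq => [|m my]; first exact: prefix_argmin_le.
rewrite !flipE block_rev_fix ?prefix_argmin_id //.
apply: (@leq_trans (pi (prefix_argmin pi m))).
  by apply: prefix_argmin_min; exact: leq_trans (prefix_argmin_le _ _) my.
by rewrite -prefix_argmin_rev prefix_argmin_min.
Qed.

Lemma block_rev_flip pi : block_rev (flip pi) =1 block_rev pi.
Proof.
move=> y; have eE : block_end (flip pi) y = block_end pi y.
  by apply: eq_card => m; rewrite !inE !prefix_argmin_flip.
by rewrite /block_rev eE prefix_argmin_flip.
Qed.

Lemma flipK : involutive flip.
Proof.
move=> pi; apply/permP=> y.
by rewrite !flipE block_rev_flip block_revK.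
Qed.

End BlockReversal.

(** * Occurrences of patterns of length 3 and their transport along [flip] *)

Section Occurrences3.

Variables (n : nat).
Implicit Types (pi : 'S_n) (i : {ffun 'I_3 -> 'I_n}) (tau : 'S_3).

Let o1 : 'I_3 := inord 1.
Let o2 : 'I_3 := inord 2.

Lemma enum_I3 : enum 'I_3 = [:: ord0; o1; o2].
Proof.
apply: (inj_map val_inj); rewrite val_enum_ord /=.
by rewrite !inordK.
Qed.

Lemma grid_posE i :
  ((grid_pos i 0 = 0) * (grid_pos i 1 = (i ord0).+1) * (grid_pos i 2 = (i o1).+1)
   * (grid_pos i 3 = (i o2).+1) * (grid_pos i 4 = n.+1))%type.
Proof. by rewrite /grid_pos enum_I3. Qed.

Lemma grid_val1 pi i : (forall j, pi (i ord0) <= pi (i j)) ->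
  grid_val pi i 1 = (pi (i ord0)).+1.
Proof.
move=> min0; rewrite /grid_val enum_I3 /=.
suff -> : sort leq [:: (pi (i ord0)).+1; (pi (i o1)).+1; (pi (i o2)).+1]
   = (pi (i ord0)).+1 :: sort leq [:: (pi (i o1)).+1; (pi (i o2)).+1] by [].
apply: (sorted_eq leq_trans anti_leq).
- exact: sort_sorted leq_total _.
- rewrite /= path_min_sorted; first exact: sort_sorted leq_total _.
  by rewrite all_sort /= !ltnS !min0.
- by rewrite perm_sort perm_cons perm_sym perm_sort.
Qed.

Lemma perm132E : (perm132 ord0 = ord0) * (perm132 o1 = o2) * (perm132 o2 = o1).
Proof.
rewrite /perm132 -/o1 -/o2; split; first split; rewrite ?tpermL ?tpermR //.
by rewrite tpermD // -val_eqE /= inordK.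
Qed.

(** Reversal puts the last two positions in decreasing order; precomposing with [perm132] makes the
    indices increasing again. *)
Definition flip_occ pi i : {ffun 'I_3 -> 'I_n} :=
  [ffun j => block_rev pi (i (perm132 j))].

(** Both sides sort the same three letters, listed in different orders. *)
Lemma grid_val_flip pi i : grid_val pi (flip_occ pi i) =1 grid_val (flip pi) i.
Proof.
move=> b; rewrite /grid_val.
suff /(perm_sortP leq_total leq_trans anti_leq)-> : perm_eq [seq (pi (flip_occ pi i j)).+1 | j <- enum 'I_3]
    [seq (flip pi (i j)).+1 | j <- enum 'I_3] by [].
rewrite !enum_I3 /= !ffunE !flipE !perm132E perm_cons.
by apply/seq.permP => P /=; rewrite !addn0 addnC.
Qed.

Definition avoids_boxes pi i (s : seq (nat * nat)) :=
  forall a b m, (a, b) \in s -> a < 4 -> b < 4 -> ~~ in_box pi i a b m.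

Lemma is_occurrenceP pi i tau (s : seq (nat * nat)) :
  reflect [/\ i ord0 < i o1 < i o2,
              forall a b, (pi (i a) < pi (i b)) = (tau a < tau b)
            & avoids_boxes pi i s]
          (is_occurrence pi i (MeshPattern tau (boxes 3 s))).
Proof.
apply: (iffP and3P) => -[inc iso av]; split.
- move/'forall_forallP: inc => inc.
  by rewrite (implyP (inc _ _)) ?(implyP (inc _ _)) //= ?inordK.
- move=> a b; have /forallP/(_ a)/forallP/(_ b) := iso.
  by move/eqP.
- move=> a b m abs a4 b4; move/forall_inP: av.
  move=> /(_ (Ordinal a4, Ordinal b4)); rewrite inE => /(_ abs).
  by move/existsPn; apply.
- apply/'forall_forallP => a b; apply/implyP.
  have := mem_enum 'I_3 a; have := mem_enum 'I_3 b; rewrite enum_I3 !inE.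
  by do 2![case/or3P => /eqP->]; rewrite ?inordK //=; lia.
- by apply/'forall_forallP => a b; rewrite iso.
- apply/forall_inP => -[a b]; rewrite inE /= => abs; apply/existsPn => m.
  exact: av.
Qed.

Variable s : seq (nat * nat).
Hypothesis row0 : [&& (0, 0) \in s, (1, 0) \in s & (2, 0) \in s].
Hypothesis col13 : forall b, 0 < b < 4 -> ((1, b) \in s) = ((3, b) \in s).

(** A general [tau] starting with its least letter covers both directions: 123 to 132 and 132 to
    123. *)
Lemma flip_occurrence pi i tau : tau ord0 = ord0 ->
  is_occurrence (flip pi) i (MeshPattern tau (boxes 3 s)) ->
  is_occurrence pi (flip_occ pi i) (MeshPattern (perm132 * tau) (boxes 3 s)).
Proof.
move=> tau0 /is_occurrenceP[/andP[xy yz] iso av].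
have [s00 s10 s20] := and3P row0.
have min0 j : flip pi (i ord0) <= flip pi (i j) by rewrite leqNgt iso tau0.
have gv1 := grid_val1 min0.
(* A letter before [i o2] and below [i ord0] would lie in box (0,0), (1,0) or (2,0). *)
have sz : prefix_argmin pi (i o2) = i ord0.
  rewrite -prefix_argmin_flip; apply: prefix_argmin_uniq => [|m mz]; first by lia.
  rewrite leqNgt; apply/negP => mlt.
  have gv0 : grid_val (flip pi) i 0 < (flip pi m).+1 < grid_val (flip pi) i 1.
    by rewrite gv1.
  have mx : m <> i ord0 by move=> mE; rewrite mE ltnn in mlt.
  have my : m <> i o1 by move=> mE; move: (min0 o1); rewrite leqNgt -mE mlt.
  have mz' : m <> i o2 by move=> mE; move: (min0 o2); rewrite leqNgt -mE mlt.
  have nx : (m : nat) <> i ord0 by move/val_inj.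
  have ny : (m : nat) <> i o1 by move/val_inj.
  have nz : (m : nat) <> i o2 by move/val_inj.
  have := av _ _ m s00 isT isT; have := av _ _ m s10 isT isT.
  have := av _ _ m s20 isT isT.
  rewrite /in_box !gv0 !andbT !grid_posE; lia.
have sx : prefix_argmin pi (i ord0) = i ord0 by rewrite -sz prefix_argmin_id.
have sy : prefix_argmin pi (i o1) = i ord0.
  by rewrite -sz; apply: prefix_argmin_between; rewrite sz; lia.
have rx := block_rev_fix sx.
have jE : ((flip_occ pi i ord0 = i ord0) * (flip_occ pi i o1 = block_rev pi (i o2))
           * (flip_occ pi i o2 = block_rev pi (i o1)))%type.
  by rewrite !ffunE !perm132E rx.
(* Either [m] lies in a later block, and blocks keep their order, or it lies in the run after the
   fixed point [i ord0], and the run is mapped to itself. *)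
have x_rev (m : 'I_n) : i ord0 < m -> i ord0 < block_rev pi m.
  move=> xm; have sxm : i ord0 <= prefix_argmin pi m.
    by rewrite -{1}sx prefix_argmin_mono // ltnW.
  move: sxm; rewrite leq_eqVlt => /orP[/eqP sm|sm]; last first.
    by rewrite -{1}rx block_rev_ltn // sx.
  have := prefix_argmin_le pi (block_rev pi m).
  rewrite prefix_argmin_rev -sm leq_eqVlt => /orP[/eqP/val_inj eqx|//].
  by move: xm; rewrite -[m](block_revK pi) -eqx rx ltnn.
have same (y' m : 'I_n) : prefix_argmin pi y' = i ord0 -> i ord0 < y' ->
    prefix_argmin pi m = i ord0 -> i ord0 < m ->
    (y' < m -> block_rev pi m < block_rev pi y').
  by move=> sy' xy' sm xm; apply: block_rev_lt; rewrite ?sy' ?sm.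
apply/is_occurrenceP; split.
- rewrite !jE x_rev /=; last lia.
  by apply: same; rewrite ?sy ?sz //; lia.
- by move=> a b; rewrite !ffunE -!flipE iso !permM.
move=> a b m abs a4 b4; apply/negP => /andP[].
(* The letter at [m] in [pi] stands at [m'] in [flip pi], and the horizontal grid lines agree. So
   the row [b] is kept, and it remains to find a shaded column of row [b] containing [m']. *)
rewrite !grid_val_flip -[m](block_revK pi) -flipE; set m' := block_rev pi m.
rewrite block_revK => colm rowm.
have noR c : (c, b) \in s -> c < 4 ->
    ~ (grid_pos i c < m'.+1 < grid_pos i c.+1).
  move=> cbs c4 colc; have := av _ _ m' cbs c4 b4.
  by rewrite /in_box colc rowm.
have sm' : prefix_argmin pi m' = prefix_argmin pi m by rewrite prefix_argmin_rev.
(* No letter of the block lies below its minimum, so row 0, about which [col13] says nothing, does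
   not occur there. *)
have b_pos : prefix_argmin pi m = i ord0 -> 0 < b.
  move=> sm; rewrite lt0n; apply/eqP => b0; move: rowm; rewrite b0 gv1 !ltnS.
  have : flip pi (i ord0) <= flip pi m'.
    by rewrite -sm -sm' -prefix_argmin_flip prefix_argmin_min.
  lia.
have sm_le := prefix_argmin_le pi m; have sm'_le := prefix_argmin_le pi m'.
have block (y' y'' : 'I_n) : prefix_argmin pi y' = i ord0 -> y' <= y'' ->
    i ord0 <= prefix_argmin pi y''.
  by move=> <-; exact: prefix_argmin_mono.
have srz : prefix_argmin pi (block_rev pi (i o2)) = i ord0 by rewrite prefix_argmin_rev.
have sry : prefix_argmin pi (block_rev pi (i o1)) = i ord0 by rewrite prefix_argmin_rev.
have xry : i ord0 < block_rev pi (i o1) by apply: x_rev; lia.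
have xrz : i ord0 < block_rev pi (i o2) by apply: x_rev; lia.
have in_block : i ord0 < m < block_rev pi (i o1) -> prefix_argmin pi m = i ord0.
  move=> /andP[xm my]; rewrite -sry; apply: prefix_argmin_between; rewrite sry; lia.
have rzy : block_rev pi (i o2) < block_rev pi (i o1).
  by apply: same; rewrite ?sy ?sz //; lia.
(* Columns 0 and 2 are kept, column 1 goes to column 3, and column 3 goes to column 1 inside the
   block of [i ord0]. *)
case: a abs a4 colm => [|[|[|[|//]]]] abs a4; rewrite !grid_posE !jE !ltnS => colm.
- apply: (noR 0) => //; rewrite !grid_posE !ltnS /=.
  rewrite -/(m' < i ord0) ltnNge; apply/negP => /(block _ _ sx); rewrite sm'; lia.
- have sm : prefix_argmin pi m = i ord0 by apply: in_block; lia.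
  apply: (noR 3) => //; first by rewrite -col13 ?b_pos.
  rewrite !grid_posE !ltnS ltn_ord andbT -[i o2](block_revK pi).
  apply: same => //; lia.
- have sm : prefix_argmin pi m = i ord0 by apply: in_block; lia.
  apply: (noR 2) => //; rewrite !grid_posE !ltnS; apply/andP; split.
    by rewrite -[i o1](block_revK pi); apply: same => //; lia.
  by rewrite -[i o2](block_revK pi); apply: same => //; lia.
have [sm|sm] := eqVneq (prefix_argmin pi m) (i ord0).
  apply: (noR 1) => //; first by rewrite col13 ?b_pos.
  rewrite !grid_posE !ltnS x_rev /=; last lia.
  by rewrite -[i o1](block_revK pi); apply: same => //; lia.
(* Past the block, [m'] lies in a later block than [i o2], so it stays in column 3. *)
apply: (noR 3) => //; rewrite !grid_posE !ltnS ltn_ord andbT.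
have lt_sm : i ord0 < prefix_argmin pi m.
  rewrite ltn_neqAle (block _ _ sry) ?andbT; last by lia.
  by rewrite eq_sym.
rewrite ltnNge; apply/negP => /(prefix_argmin_mono pi).
by rewrite sz sm' leqNgt lt_sm.
Qed.

Lemma flip_occK pi : involutive (flip_occ pi).
Proof.
move=> i; apply/ffunP => j; rewrite !ffunE block_revK.
by rewrite /perm132 tpermK.
Qed.

Lemma flip_occurrences_le pi tau : tau ord0 = ord0 ->
  occurrences (MeshPattern tau (boxes 3 s)) (flip pi)
  <= occurrences (MeshPattern (perm132 * tau) (boxes 3 s)) pi.
Proof.
move=> tau0; rewrite /occurrences -(card_imset _ (inv_inj (flip_occK pi))).
apply/subset_leq_card/subsetP => _ /imsetP[i + ->]; rewrite !inE.
exact: flip_occurrence.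
Qed.

(** The inequality is used twice: for 123 at [pi], and for 132 at [flip pi]. Since [flip] and
    [perm132] are involutions, the second use is the reverse inequality. *)
Lemma flip_occurrences pi :
  occurrences (MeshPattern perm123 (boxes 3 s)) (flip pi)
  = occurrences (MeshPattern perm132 (boxes 3 s)) pi.
Proof.
apply/eqP; rewrite eqn_leq -{1}[perm132]mulg1 flip_occurrences_le ?perm1 //=.
have := @flip_occurrences_le (flip pi) perm132 perm132E.1.1.
by rewrite flipK [(perm132 * perm132)%g]tperm2.
Qed.

End Occurrences3.

(** * Equidistribution, and the seven shadings *)

Lemma equidistributed_boxes (s : seq (nat * nat)) :
  [&& (0, 0) \in s, (1, 0) \in s & (2, 0) \in s] ->
  (forall b, 0 < b < 4 -> ((1, b) \in s) = ((3, b) \in s)) ->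
  equidistributed (MeshPattern perm123 (boxes 3 s)) (MeshPattern perm132 (boxes 3 s)).
Proof.
move=> row0 col13 n l.
rewrite -(card_imset _ (inv_inj (@flipK n))); apply: eq_card => pi.
rewrite -[pi in LHS](flipK pi) mem_imset; last exact: inv_inj (@flipK n).
by rewrite !inE flip_occurrences.
Qed.

Theorem theorem3p2 (R : {set 'I_4 * 'I_4})
  (hR : R \in [::
    boxes 3 [:: (0,0); (0,1); (0,2); (1,0); (2,0); (2,2)];
    boxes 3 [:: (0,0); (0,1); (0,2); (1,0); (1,2); (2,0); (2,1); (2,3); (3,2)];
    boxes 3 [:: (0,0); (0,1); (0,2); (1,0); (1,1); (1,3); (2,0); (3,1); (3,3)];
    boxes 3 [:: (0,0); (0,1); (0,2); (1,0); (1,1); (1,3); (2,0); (2,2); (3,1);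
                (3,3)];
    boxes 3 [:: (0,0); (0,1); (0,2); (1,0); (1,2); (2,0); (2,1); (2,2); (2,3);
                (3,2)];
    boxes 3 [:: (0,0); (0,1); (0,2); (1,0); (1,1); (1,2); (1,3); (2,0); (2,1);
                (2,3); (3,1); (3,2); (3,3)];
    boxes 3 [:: (0,0); (0,1); (0,2); (1,0); (1,1); (1,2); (1,3); (2,0); (2,1);
                (2,2); (2,3); (3,1); (3,2); (3,3)]]) :
  equidistributed (MeshPattern perm123 R) (MeshPattern perm132 R).
Proof.
move: hR; rewrite !inE; do ![case/orP]; move=> /eqP->.
(* Both conditions are finite checks on the lists: only rows 1, 2 and 3 have to be compared, the
   other values of [b] being excluded by the range. *)
all: by apply: equidistributed_boxes => // -[|[|[|[|]]]].
Qed.
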